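(* Let $\mathbb U$ be a countable homogeneous structure in a countable first-order language, and let $\mathcal F$ denote its age. Assume that $\mathbb U$ is an amalgamation base in $\sigma\mathcal F$ and that $\operatorname{Emb}(\mathbb U)\neq\operatorname{Aut}(\mathbb U)$, i.e. there is a self-embedding of $\mathbb U$ which is not surjective. Then there exists a homogeneous structure of cardinality $\aleph_1$ whose age is $\mathcal F$.
   Context: A first-order structure is homogeneous if every isomorphism between finitely generated substructures extends to an automorphism of the whole structure. The age of a structure $M$ is the class of all finitely generated structures embeddable into $M$. $\operatorname{Emb}(\mathbb U)$ is the monoid of all embeddings $\mathbb U\to\mathbb U$ under composition, and $\operatorname{Aut}(\mathbb U)$ is its group of automorphisms. For the age $\mathcal F$ of $\mathbb U$, $\sigma\mathcal F$ denotes the class of all countable (equivalently, countably generated) structures whose age is contained in $\mathcal F$. $\mathbb U$ is an amalgamation base in $\sigma\mathcal F$ if for every two embeddings $f:\mathbb U\to X$, $g:\mathbb U\to Y$ with $X,Y\in\sigma\mathcal F$ there exist $W\in\sigma\mathcal F$ and embeddings $f':X\to W$, $g':Y\to W$ with $f'\circ f=g'\circ g$. *)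

(* Defs.v *)
From mathcomp Require Import all_boot.
From mathcomp Require Import boolp classical_sets functions cardinality.

Set Implicit Arguments.
Unset Strict Implicit.
Unset Printing Implicit Defensive.

Local Open Scope classical_set_scope.
Local Open Scope card_scope.

(* Constants are the function symbols of arity 0. *)
Record language := Language {
  fun_sym : Type;
  rel_sym : Type;
  fun_arity : fun_sym -> nat;
  rel_arity : rel_sym -> nat }.

Definition countable_language (L : language) : Prop :=
  countable [set: fun_sym L] /\ countable [set: rel_sym L].

(* The carrier may be empty (when [L] has no constants). *)
Record structure (L : language) := Structure {
  carrier :> Type;
  fun_interp : forall f : fun_sym L, (fun_arity f).-tuple carrier -> carrier;
  rel_interp : forall r : rel_sym L, set ((rel_arity r).-tuple carrier) }.

Section Structures.
Variable L : language.
Implicit Types M N U : structure L.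

Definition embedding M N (h : M -> N) : Prop :=
  [/\ injective h,
      forall (f : fun_sym L) (t : (fun_arity f).-tuple M),
        h (fun_interp t) = fun_interp (map_tuple h t)
    & forall (r : rel_sym L) (t : (rel_arity r).-tuple M),
        rel_interp t <-> rel_interp (map_tuple h t)].

Definition isomorphism M N (h : M -> N) : Prop := embedding h /\ bijective h.

Definition Emb M : set (M -> M) := [set h | embedding h].

Definition Aut M : set (M -> M) := [set h | isomorphism h].

Definition closed_under_functions M (A : set M) : Prop :=
  forall (f : fun_sym L) (t : (fun_arity f).-tuple M),
    (forall i, A (tnth t i)) -> A (fun_interp t).

Record substructure M := Substructure {
  sub_set : set M;
  sub_closed : closed_under_functions sub_set }.

Lemma sub_fun_subproof M (S : substructure M) (f : fun_sym L)
    (t : (fun_arity f).-tuple {x : M | sub_set S x}) :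
  sub_set S (fun_interp (map_tuple sval t)).
Proof. by apply: sub_closed => i; rewrite tnth_map; apply: svalP. Qed.

Definition structure_of_sub M (S : substructure M) : structure L :=
  @Structure L {x : M | sub_set S x}
    (fun f t => exist _ (fun_interp (map_tuple sval t)) (sub_fun_subproof t))
    (fun r => [set t | rel_interp (map_tuple sval t)]).

Coercion structure_of_sub : substructure >-> structure.

Definition generated M (X : set M) : set M :=
  smallest (@closed_under_functions M) X.

Definition finitely_generated M : Prop :=
  exists X : set M, finite_set X /\ generated X = [set: M].

Definition homogeneous M : Prop :=
  forall (A B : substructure M) (h : A -> B),
    finitely_generated A -> finitely_generated B -> isomorphism h ->
    exists2 g : M -> M, Aut g & forall a : A, g (sval a) = sval (h a).

(* Classes of structures are predicates [structure L -> Prop]: using [set] here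
   would force the universe of [set] strictly above that of carriers. *)
Definition age M : structure L -> Prop :=
  fun A => finitely_generated A /\ exists h : A -> M, embedding h.

Definition sigma (F : structure L -> Prop) : structure L -> Prop :=
  fun X => countable [set: X] /\ forall A, age X A -> F A.

Definition amalgamation_base (K : structure L -> Prop) U : Prop :=
  forall (X Y : structure L) (f : U -> X) (g : U -> Y),
    K X -> K Y -> embedding f -> embedding g ->
    exists (W : structure L) (f' : X -> W) (g' : Y -> W),
      [/\ K W, embedding f', embedding g' & f' \o f = g' \o g].

End Structures.

Arguments Emb {L} M _.
Arguments Aut {L} M _.

(* [T] has the least uncountable cardinality. *)
Definition has_cardinality_aleph1 (T : Type) : Prop :=
  ~ countable [set: T] /\
  forall T' : Type, ~ countable [set: T'] -> [set: T] #<= [set: T'].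

(* Main.v *)
(** Write E for the monoid of self-embeddings of U. Every countable structure
    with age inside that of U embeds into U, so the hypothesis on U says that E
    has amalgamation: for f, g in E there are f', g' in E with f' f = g' g.
    Moreover the direct limit of any sequence U -> U -> ... of maps in E is again
    isomorphic to U. Iterating amalgamation and passing to the limit, one finds,
    for countably many automorphisms h_n of U, a non-surjective k in E and
    automorphisms g_n with g_n k = k h_n.

    Consider the copies of U inside a fixed uncountable set, each equipped with
    one automorphism for each finite partial isomorphism, and ordered by
    extension of all these data. Every increasing sequence of such copies has a
    strict upper bound, so no countable subset of a maximal chain is cofinal in
    it. The union M of a maximal chain is therefore uncountable, and it has
    cardinality aleph_1, being the union of a chain of countable sets. Each
    finite partial isomorphism of M extends to M, by the union of the
    automorphisms chosen for it along the chain. Using Zorn's lemma for the chain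
    avoids a transfinite recursion along omega_1. *)

Require Import Defs.
From mathcomp Require Import all_boot.
From mathcomp Require Import boolp classical_sets functions cardinality.

Local Open Scope classical_set_scope.

(** * Functions, countable sets and chains *)

Lemma inj_surj_bijective {A B : Type} (f : A -> B) :
  injective f -> (forall y, exists x, f x = y) -> bijective f.
Proof.
move=> finj fsurj; have [g gP] := choice fsurj.
by exists g => // x; apply: finj; rewrite gP.
Qed.

Lemma bijective_surj {A B : Type} (f : A -> B) :
  bijective f -> forall y, exists x, f x = y.
Proof. by case=> g _ gK y; exists (g y). Qed.

Lemma finite_list {T : Type} (X : set T) :
  finite_set X -> exists s : seq {classic T}, X = [set` s].
Proof. by move=> /(@finite_seqP {classic T}). Qed.

Lemma finite_cover {T X : Type} (P : T -> set X) :
  inhabited T ->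
  (forall s t, exists r, P s `<=` P r /\ P t `<=` P r) ->
  (forall x, exists s, P s x) ->
  forall F, finite_set F -> exists s, F `<=` P s.
Proof.
move=> [t0] dir cov F /finite_list[l ->]; elim: l => [|x l [s sP]].
  by exists t0 => x; rewrite /= in_nil.
have [t tP] := cov x; have [r [sr tr]] := dir s t.
exists r => y /=; rewrite in_cons => /orP[/eqP->|yl]; first exact/tr.
exact/sr/sP.
Qed.

Lemma glue_fun {T : Type} {D : T -> Type} {X Y : Type}
    (i : forall s, D s -> X) (q : forall s, D s -> Y) :
  (forall x, exists s d, i s d = x) ->
  (forall s t d d', i s d = i t d' -> q s d = q t d') ->
  exists g, forall s d, g (i s d) = q s d.
Proof.
move=> cov cst.
have /choice[g gP] : forall x, exists y, exists s d, i s d = x /\ q s d = y.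
  by move=> x; have [s [d <-]] := cov x; exists (q s d), s, d.
exists g => s d; have [t [d' [e <-]]] := gP (i s d); exact: cst.
Qed.

Lemma countable_surj {T : Type} (x0 : T) :
  countable [set: T] -> exists e : nat -> T, forall x, exists n, e n = x.
Proof.
move=> /countable_injP[r rinj].
have rI : injective r by move=> x y; apply: rinj; rewrite inE.
have /choice[e eP] : forall n, exists y, forall x, r x = n -> y = x.
  move=> n; have [[x xn]|nx] := pselect (exists x, r x = n).
    by exists x => y yn; apply: rI; rewrite xn.
  by exists x0 => y yn; case: nx; exists y.
by exists e => x; exists (r x); apply: eP.
Qed.

Lemma map_tuple_comp {X Y Z : Type} (f : X -> Y) (g : Y -> Z) n (t : n.-tuple X) :
  map_tuple g (map_tuple f t) = map_tuple (g \o f) t.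
Proof. by apply: eq_from_tnth => i; rewrite !tnth_map. Qed.

Lemma map_tuple_inj {X Y : Type} (f : X -> Y) n :
  injective f -> injective (@map_tuple n X Y f).
Proof.
move=> finj s t e; apply: eq_from_tnth => i; apply: finj.
by have := congr1 (fun u : n.-tuple Y => tnth u i) e; rewrite !tnth_map.
Qed.

Lemma tuple_range {X Y : Type} (f : X -> Y) n (t : n.-tuple Y) :
  [set tnth t j | j in [set: 'I_n]] `<=` range f -> exists x, t = map_tuple f x.
Proof.
move=> tf; have /choice[x xP] : forall j, exists x, f x = tnth t j.
  by move=> j; have [|x _ <-] := tf (tnth t j); [exists j|exists x].
by exists (mktuple x); apply: eq_from_tnth => j; rewrite tnth_map tnth_mktuple.
Qed.

Lemma chain_mono {T : Type} (R : T -> T -> Prop) (s : nat -> T) :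
  (forall x, R x x) -> (forall x y z, R x y -> R y z -> R x z) ->
  (forall n, R (s n) (s n.+1)) -> forall m n, m <= n -> R (s m) (s n).
Proof.
move=> Rr Rt sR m; elim=> [|n IH]; first by rewrite leqn0 => /eqP->.
by rewrite leq_eqVlt => /orP[/eqP->//|/IH/Rt]; apply.
Qed.

(* [transit k n m] is [k (m - 1) \o ... \o k n], and the identity if [m <= n]. *)
Fixpoint transit {T : Type} (k : nat -> T -> T) (n m : nat) : T -> T :=
  if m is m'.+1 then (if n <= m' then k m' \o transit k n m' else id) else id.

Lemma transit_id {T : Type} (k : nat -> T -> T) n m : m <= n -> transit k n m = id.
Proof. by case: m => //= m; rewrite leqNgt => /negbTE; rewrite ltnS => ->. Qed.

Lemma transitS {T : Type} (k : nat -> T -> T) n m x :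
  n <= m -> transit k n m.+1 x = k m (transit k n m x).
Proof. by move=> /= ->. Qed.

Lemma transit_first {T : Type} (k : nat -> T -> T) n m x :
  n < m -> transit k n m x = transit k n.+1 m (k n x).
Proof.
elim: m => // m IH; rewrite ltnS leq_eqVlt => /orP[/eqP<-|nm].
  by rewrite transitS // !transit_id.
by rewrite !transitS ?IH // ltnW.
Qed.

Lemma transit_cocone {T X : Type} (k : nat -> T -> T) (i : nat -> T -> X) n m x :
  (forall n x, i n.+1 (k n x) = i n x) -> n <= m -> i m (transit k n m x) = i n x.
Proof.
move=> ik; elim: m => [|m IH]; first by rewrite leqn0 => /eqP->.
rewrite leq_eqVlt => /orP[/eqP->|nm]; first by rewrite transit_id.
by rewrite transitS // ik IH.
Qed.

(** Two representatives of one point are moved by [transit] to the copy [maxn m n], where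
    injectivity identifies them. *)
Lemma cocone_glue_fun {T X Y : Type} (k : nat -> T -> T) (i : nat -> T -> X) (q : nat -> T -> Y) :
  (forall n, injective (i n)) -> (forall n x, i n.+1 (k n x) = i n x) ->
  (forall n x, q n.+1 (k n x) = q n x) -> (forall y, exists n x, i n x = y) ->
  exists g, forall n x, g (i n x) = q n x.
Proof.
move=> iI ik qk cov; apply: glue_fun => // m n x y.
rewrite -(transit_cocone k i _ (maxn m n) x ik) ?leq_maxl //.
rewrite -(transit_cocone k i _ (maxn m n) y ik) ?leq_maxr // => /iI xy.
rewrite -(transit_cocone k q _ (maxn m n) x qk) ?leq_maxl // xy.
by rewrite (transit_cocone k q) ?leq_maxr.
Qed.

(** An upper bound of a maximal chain [C] lies in [C]. A sequence in [C] without strict upper bound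
    in [C] would be cofinal in it; a strict bound of its running maxima would then bound [C], lie in
    [C], and be below some [s n], which is absurd. *)
Lemma Zorn_strict_chain {T : Type} (le : T -> T -> Prop) :
  inhabited T -> (forall x, le x x) -> (forall x y z, le x y -> le y z -> le x z) ->
  (forall s : nat -> T, (forall n, le (s n) (s n.+1)) ->
    exists t, forall n, le (s n) t /\ ~ le t (s n)) ->
  exists C : set T, [/\ total_on C le, C !=set0 & forall s : nat -> T,
    (forall n, C (s n)) -> exists2 t, C t & forall n, le (s n) t /\ ~ le t (s n)].
Proof.
move=> [x0] lexx letr bound.
have [|C [Ctot Cmax]] := @Zorn_bigcup T [set C | total_on C le].
  move=> F FP Ftot x y [A FA Ax] [B FB By].
  by have [AB|BA] := Ftot A B FA FB; [apply: (FP B)|apply: (FP A)] => //; [apply: AB|apply: BA].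
have Cub u : (forall c, C c -> le c u) -> C u.
  move=> Cu; apply: contrapT => nCu; apply: (Cmax (C `|` [set u])).
    by split; [move=> x; left|move=> /(_ u (or_intror erefl))].
  by move=> x y [Cx|->] [Cy|->]; [apply: Ctot|left; apply: Cu|right; apply: Cu|left].
exists C; split=> // [|s sC].
  have [|t _] := bound (fun=> x0); first by [].
  by have [//|/set0P/negP/negPn/eqP C0] := pselect (C !=set0); exists t; apply: Cub => c; rewrite C0.
apply: contrapT => nub.
have cof t : C t -> exists n, le t (s n).
  move=> Ct; apply: contrapT => nle; apply: nub; exists t => // n.
  have ntn : ~ le t (s n) by move=> tn; apply: nle; exists n.
  by split=> //; have [//|] := Ctot _ _ (sC n) Ct.
have /choice[mx mxP] : forall xy : T * T, exists z, C xy.1 -> C xy.2 ->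
    [/\ C z, le xy.1 z & le xy.2 z].
  move=> [x y] /=; have [xy|nxy] := pselect (le x y); first by exists y.
  by exists x => Cx Cy; have [//|yx] := Ctot _ _ Cx Cy.
(* [bound] wants an increasing sequence and [s] is arbitrary, so [s] is replaced by its running
   maxima. *)
pose fix m n := if n is n'.+1 then mx (m n', s n) else s 0.
have mC n : C (m n) by elim: n => //= n IH; have [] := mxP (m n, s n.+1) IH (sC _).
have sm n : le (s n) (m n) by case: n => //= n; have [] := mxP (m n, s n.+1) (mC n) (sC _).
have [|u uP] := bound m; first by move=> n; have [] := mxP (m n, s n.+1) (mC n) (sC _).
have Cu : C u.
  by apply: Cub => c /cof[n cn]; apply: (letr _ _ _ cn); apply: (letr _ _ _ (sm n)); have [] := uP n.
by have [n un] := cof u Cu; have [_] := uP n; apply; apply: (letr _ _ _ un).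
Qed.

(** The complement of [B] is infinite, since otherwise even codes on [B] and odd codes off [B] would
    make [Y] countable. So [nat] injects into it, and [A] injects into [nat]. *)
Lemma countable_avoid {X Y : Type} (A : set X) (B : set Y) :
  countable A -> countable B -> ~ countable [set: Y] ->
  exists2 j : X -> Y, (forall x y, A x -> A y -> j x = j y -> x = y) & forall x, ~ B (j x).
Proof.
move=> /countable_injP[r rI] Bc Yunc.
have : infinite_set (~` B).
  move=> Bf; apply: Yunc; rewrite -(setUv B).
  have /countable_injP[f fI] := Bc; have /countable_injP[g gI] := finite_set_countable Bf.
  apply/countable_injP; exists (fun y => if pselect (B y) then (f y).*2 else (g y).*2.+1).
  move=> x y _ _ /=; case: pselect => Bx; case: pselect => By.
  - by move=> /double_inj; apply: fI; rewrite inE.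
  - by move=> /(congr1 odd); rewrite /= !odd_double.
  - by move=> /(congr1 odd); rewrite /= !odd_double.
  - by move=> [/double_inj]; apply: gI; rewrite inE.
move=> /infiniteP/card_leP[h].
exists (fun x => set_val (h (to_setT (r x)))) => [x y Ax Ay /= e|x].
  apply: rI; rewrite ?inE //.
  suff /(congr1 val) : to_setT (r x) = to_setT (r y) by [].
  by apply: (@inj _ _ _ h); rewrite ?inE //; apply: val_inj.
by have := set_valP (h (to_setT (r x))).
Qed.

Lemma uncountable_set_nat : ~ countable [set: set nat].
Proof.
(* Cantor's diagonal set. *)
move=> /(countable_surj set0)[e eP]; have [n en] := eP [set n | ~ e n n].
have E : e n n = (~ e n n) by have /= := congr1 (fun A : set nat => A n) en.
have np : ~ e n n by move=> p; move: (p); rewrite E; apply.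
by apply: (np); rewrite E.
Qed.

(** Zorn's lemma for graphs of partial injections. If a maximal one misses a point of [A s], its
    domain lies inside [A s], so it uses only countably many values and the rest of [A s] can be
    sent to fresh ones. *)
Lemma bigcup_chain_card_le {T X Y : Type} (C : set T) (A : T -> set X) :
  (forall s t, C s -> C t -> A s `<=` A t \/ A t `<=` A s) ->
  (forall s, C s -> countable (A s)) -> ~ countable [set: Y] ->
  exists j : X -> Y, forall x y, (\bigcup_(s in C) A s) x -> (\bigcup_(s in C) A s) y ->
    j x = j y -> x = y.
Proof.
move=> Atot Ac Yunc.
pose dom (F : set (X * Y)) := [set x | exists y, F (x, y)].
(* The third clause makes the domain comparable with every [A s]; this yields [domA] below. *)
pose P := [set F : set (X * Y) | [/\ forall x y y', F (x, y) -> F (x, y') -> y = y',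
  forall x x' y, F (x, y) -> F (x', y) -> x = x' &
  forall s x, C s -> dom F x -> ~ A s x -> A s `<=` dom F]].
have [|F [[Ffun Finj Fdom] Fmax]] := @Zorn_bigcup _ P.
  move=> G GP Gtot.
  have two p q : (\bigcup_(F in G) F) p -> (\bigcup_(F in G) F) q ->
      exists F, [/\ G F, F p & F q].
    move=> [F1 G1 p1] [F2 G2 q2]; have [FF|FF] := Gtot _ _ G1 G2.
      by exists F2; split=> //; apply: FF.
    by exists F1; split=> //; apply: FF.
  split.
  - by move=> x y y' p q; have [F [/GP[FF _ _] Fp Fq]] := two _ _ p q; apply: FF Fp Fq.
  - by move=> x x' y p q; have [F [/GP[_ FF _] Fp Fq]] := two _ _ p q; apply: FF Fp Fq.
  - move=> s x Cs [y [F GF Fxy]] nx z Az; have [_ _ Fd] := GP F GF.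
    by have [w Fzw] := Fd s x Cs (ex_intro _ y Fxy) nx z Az; exists w, F.
have [all|/existsNP[x /not_implyP[[s Cs Asx] nx]]] :=
    pselect (forall x, (\bigcup_(s in C) A s) x -> dom F x).
  have /choice[j jP] : forall x, exists y, (\bigcup_(s in C) A s) x -> F (x, y).
    move=> x; have [/all[y Fy]|nx] := pselect ((\bigcup_(s in C) A s) x); first by exists y.
    have [y _] : exists y : Y, True; last by exists y.
    apply: contrapT => nY; apply: Yunc; suff -> : [set: Y] = set0 by apply: countable0.
    by apply/seteqP; split=> // y _; apply: nY; exists y.
  exists j => x y Ax Ay e; apply: (Finj _ _ (j x)); first exact: jP.
  by rewrite e; apply: jP.
have domA : dom F `<=` A s.
  by move=> z Fz; apply: contrapT => nz; apply: nx; apply: (Fdom s z).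
have cod : countable [set y | exists x, F (x, y)].
  have /countable_injP[r rI] := Ac s Cs.
  have /choice[g gP] : forall y, exists x, (exists x, F (x, y)) -> F (x, y).
    move=> y; have [[z Fz]|nz] := pselect (exists x, F (x, y)); first by exists z.
    by exists x => /nz.
  apply/countable_injP; exists (r \o g) => y y'; rewrite !inE /= => /gP Fy /gP Fy' /rI e.
  have E : g y = g y' by apply: e; rewrite inE; apply: domA; [exists y|exists y'].
  by apply: Ffun Fy _; rewrite E.
have [j jI jF] := countable_avoid _ _ (Ac s Cs) cod Yunc.
pose F' := F `|` [set p | [/\ A s p.1, ~ dom F p.1 & p.2 = j p.1]].
have F'dom : dom F' = A s.
  apply/seteqP; split=> z; first by move=> [y [Fy|[]//]]; apply: domA; exists y.
  move=> Az; have [[y Fy]|nz] := pselect (dom F z); first by exists y; left.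
  by exists (j z); right.
exfalso; apply: (Fmax F').
  split=> [p|sub]; first by left.
  by apply: (nx); exists (j x); apply: sub; right.
split.
- move=> z y y' [Fy|[/= _ nz ->]] [Fy'|[/= _ nz' ->]] //; first exact: Ffun Fy Fy'.
    by case: nz'; exists y.
  by case: nz; exists y'.
- move=> z z' y [Fy|[/= Az nz e]] [Fy'|[/= Az' nz' e']]; first exact: Finj Fy Fy'.
  + by case: (jF z'); exists z; rewrite -e'.
  + by case: (jF z); exists z'; rewrite -e.
  + by apply: jI => //; rewrite -e -e'.
- rewrite F'dom => t z Ct Az nz; have [//|/(_ _ Az)//] := Atot _ _ Ct Cs.
Qed.

(** * Embeddings and finitely generated structures *)

Section Embeddings.
Context {L : language}.
Implicit Types M N A B D U W : structure L.

Lemma embedding_id M : embedding (@id M).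
Proof.
split=> // [f t|r t]; first by congr fun_interp; apply: eq_from_tnth => i; rewrite tnth_map.
by have -> : map_tuple id t = t by apply: eq_from_tnth => i; rewrite tnth_map.
Qed.

Lemma embedding_comp M N D (h : M -> N) (g : N -> D) :
  embedding h -> embedding g -> embedding (g \o h).
Proof.
move=> [hI hf hr] [gI gf gr]; split=> [|f t|r t]; first exact: inj_comp.
  by rewrite /= hf gf map_tuple_comp.
by rewrite hr gr map_tuple_comp.
Qed.

Lemma embedding_cancel M N D (h : M -> N) (g : N -> D) :
  embedding g -> embedding (g \o h) -> embedding h.
Proof.
move=> [gI gf gr] [hI hf hr]; split=> [x y e|f t|r t].
- by apply: hI => /=; rewrite e.
- by apply: gI; rewrite gf map_tuple_comp; apply: hf.
- by rewrite hr gr map_tuple_comp.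
Qed.

Lemma embedding_ext M N (h g : M -> N) : h =1 g -> embedding h -> embedding g.
Proof. by move=> /funext ->. Qed.

Lemma isomorphism_id M : isomorphism (@id M).
Proof. by split; [apply: embedding_id|exists id]. Qed.

Lemma isomorphism_comp M N D (h : M -> N) (g : N -> D) :
  isomorphism h -> isomorphism g -> isomorphism (g \o h).
Proof.
move=> [he hb] [ge gb]; split; first exact: embedding_comp.
exact: bij_comp.
Qed.

Lemma isomorphism_inv M N (h : M -> N) : isomorphism h ->
  exists g : N -> M, [/\ isomorphism g, cancel h g & cancel g h].
Proof.
case=> he hb; have [g hK gK] := hb; exists g; split=> //; split; last by exists h.
apply: (embedding_cancel _ _ _ _ h) => //.
by apply: embedding_ext (embedding_id N) => x /=; rewrite gK.
Qed.

Lemma isomorphism_surj M N (h : M -> N) : embedding h ->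
  (forall y, exists x, h x = y) -> isomorphism h.
Proof. by move=> he hs; split=> //; apply: inj_surj_bijective => //; case: he. Qed.

(** Each condition on [g] involves finitely many points: two points, the entries of a tuple, or
    these entries together with the value of a function symbol. *)
Lemma embedding_local M N (g : M -> N) :
  (forall F : set M, finite_set F -> exists D (i : D -> M) (j : D -> N),
     [/\ embedding i, embedding j & forall x, F x -> exists2 y, i y = x & g x = j y]) ->
  embedding g.
Proof.
move=> loc; split=> [x y e|f t|r t].
- have [|D [i [j [_ [jI _ _] ij]]]] := loc [set x; y].
    by rewrite finite_setU; split; apply: finite_set1.
  have [x' ix gx] := ij x (or_introl erefl).
  have [y' iy gy] := ij y (or_intror erefl).
  by rewrite -ix -iy; congr i; apply: jI; rewrite -gx -gy.
- have [|D [i [j [[iI ie _] [_ je _] ij]]]] :=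
    loc ([set fun_interp t] `|` [set tnth t i | i in [set: 'I_(fun_arity f)]]).
    by rewrite finite_setU; split; [apply: finite_set1|apply: finite_image].
  have /choice[y yP] : forall k, exists y, i y = tnth t k /\ g (tnth t k) = j y.
    by move=> k; have [|y] := ij (tnth t k); [right; exists k|exists y].
  have [z iz ->] := ij (fun_interp t) (or_introl erefl).
  have tE : t = map_tuple i (mktuple y).
    by apply: eq_from_tnth => k; rewrite tnth_map tnth_mktuple; case: (yP k).
  have -> : z = fun_interp (mktuple y) by apply: iI; rewrite iz ie -tE.
  rewrite je; congr fun_interp; apply: eq_from_tnth => k.
  by rewrite (tnth_map j) (tnth_map g) tnth_mktuple; case: (yP k).
- have [|D [i [j [[_ _ ie] [_ _ je] ij]]]] :=
    loc [set tnth t i | i in [set: 'I_(rel_arity r)]]; first exact: finite_image.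
  have /choice[y yP] : forall k, exists y, i y = tnth t k /\ g (tnth t k) = j y.
    by move=> k; have [|y] := ij (tnth t k); [exists k|exists y].
  have tE : t = map_tuple i (mktuple y).
    by apply: eq_from_tnth => k; rewrite tnth_map tnth_mktuple; case: (yP k).
  rewrite [in X in X <-> _]tE -ie je; have -> // : map_tuple j (mktuple y) = map_tuple g t.
  apply: eq_from_tnth => k.
  by rewrite (tnth_map j) (tnth_map g) tnth_mktuple; case: (yP k).
Qed.

Lemma glue_embedding {T : Type} {D : T -> structure L} M N
    (i : forall s, D s -> M) (g : M -> N) :
  inhabited T ->
  (forall s, embedding (i s)) -> (forall s, embedding (g \o i s)) ->
  (forall s t, exists r, range (i s) `<=` range (i r) /\ range (i t) `<=` range (i r)) ->
  (forall x, exists s d, i s d = x) -> embedding g.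
Proof.
move=> T0 ie ge dir cov; apply: embedding_local => F /(finite_cover (fun s => range (i s))).
case=> // [x|s sP]; first by have [s [d <-]] := cov x; exists s, d.
exists (D s), (i s), (g \o i s); split=> // x /sP[d _ <-].
by exists d.
Qed.

Lemma generated_closed M (X : set M) : closed_under_functions (generated X).
Proof.
move=> f t tX C [Cc XC]; apply: (Cc) => i; exact: tX.
Qed.

Lemma generated_embedding_eq M N (f g : M -> N) (X : set M) :
  generated X = [set: M] -> embedding f -> embedding g ->
  (forall x, X x -> f x = g x) -> f =1 g.
Proof.
move=> gX [_ fe _] [_ ge _] fgX x.
have: generated X x by rewrite gX.
apply: (@smallest_sub _ _ _ [set x | f x = g x]) => // F t tE.
by rewrite /= fe ge; congr fun_interp; apply: eq_from_tnth => i; rewrite !tnth_map tE.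
Qed.

Lemma range_closed M N (f : M -> N) : embedding f ->
  closed_under_functions (range f).
Proof.
move=> [_ fe _] F t tf.
have [|y ->] := tuple_range f _ t; first by move=> _ [k _ <-]; apply: tf.
by exists (fun_interp y).
Qed.

Lemma generated_range M N D (f : M -> D) (g : N -> D) (X : set M) :
  generated X = [set: M] -> embedding f -> embedding g ->
  (forall x, X x -> range g (f x)) -> range f `<=` range g.
Proof.
move=> gX [_ fe _] ge fgX _ [x _ <-].
have: generated X x by rewrite gX.
apply: (@smallest_sub _ _ _ [set x | range g (f x)]) => // F t tE.
by rewrite /= fe; apply: range_closed => // i; rewrite tnth_map; apply: tE.
Qed.

Lemma lift_embedding M N D (f : M -> D) (g : N -> D) :
  embedding f -> embedding g -> range f `<=` range g ->
  exists2 h : M -> N, embedding h & forall x, g (h x) = f x.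
Proof.
move=> fe ge fg; have /choice[h hP] : forall x, exists y, g y = f x.
  by move=> x; have [|y _ <-] := fg (f x); [exists x|exists y].
exists h => //; apply: (embedding_cancel _ _ _ _ g) => //.
by apply: embedding_ext fe => x /=; rewrite hP.
Qed.

Lemma sub_embedding M (S : substructure M) : embedding (sval : S -> M).
Proof. by split=> // x y; apply: eq_sig_hprop => *; apply: Prop_irrelevance. Qed.

Lemma fg_image M N (f : M -> N) : embedding f -> (forall y, exists x, f x = y) ->
  finitely_generated M -> finitely_generated N.
Proof.
move=> fe fs [X [Xfin gX]]; exists (f @` X); split; first exact: finite_image.
apply/seteqP; split=> // y _ C [Cc XC]; have [x <-] := fs y.
have: generated X x by rewrite gX.
apply: (@smallest_sub _ _ _ [set x | C (f x)]) => [F t tE|z Xz]; last by apply: XC; exists z.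
have [_ fF _] := fe; rewrite /= fF; apply: Cc => i; rewrite tnth_map; exact: tE.
Qed.

Lemma fg_generated M (X : set M) : finite_set X ->
  finitely_generated (Substructure (generated_closed M X)).
Proof.
move=> Xfin; have XS x : X x -> generated X x by apply: sub_gen_smallest.
pose S := Substructure (generated_closed M X).
exists (sval @^-1` X : set S); split.
  by apply: finite_preimage => // x y _ _; have [+ _ _] := sub_embedding M S; apply.
apply/seteqP; split=> // -[y yS] _ C [Cc XC].
(* [C] lives on the subtype; quantifying over the membership proof turns it into a predicate on [M],
   to which minimality of [generated X] applies. *)
have: exists h : sub_set S y, C (exist _ y h); last first.
  by case=> h; rewrite (Prop_irrelevance h yS).
have := yS.
apply: (@smallest_sub _ _ _ [set w | exists h : sub_set S w, C (exist _ w h)]) => [F t tE|x Xx]; last first.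
  by exists (XS x Xx); apply: XC.
have /choice[z zP] : forall k, exists z : S, sval z = tnth t k /\ C z.
  by move=> k; have [h Ch] := tE k; exists (exist _ _ h).
have tz : t = map_tuple sval (mktuple z).
  by apply: eq_from_tnth => k; rewrite tnth_map tnth_mktuple; case: (zP k).
rewrite tz; exists (@sub_fun_subproof _ _ S F (mktuple z)).
suff : C (fun_interp (mktuple z)) by [].
by apply: Cc => i; rewrite tnth_mktuple; case: (zP i).
Qed.

End Embeddings.

(** * Self-embeddings of a countable homogeneous structure *)

Section Homogeneity.
Context {L : language}.
Implicit Types M N A B D U W : structure L.

Lemma range_isomorphism A M (f : A -> M) (fe : embedding f) :
  exists2 f' : A -> Substructure (range_closed A M f fe),
    isomorphism f' & forall x, sval (f' x) = f x.
Proof.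
set S := Substructure _; have Se := sub_embedding M S.
have [|f' f'e f'E] := lift_embedding _ _ _ _ _ fe Se.
  by move=> _ [x _ <-]; have fx : range f (f x) by []; exists (exist _ _ fx : S).
exists f' => //; apply: isomorphism_surj => // y.
have [x _ fx] := svalP y; exists x.
by have [sI _ _] := Se; apply: sI; rewrite f'E.
Qed.

(** Homogeneity speaks of substructures, so [f] and [g] are replaced by the isomorphisms onto their
    ranges; the map to extend is the inverse of the first followed by the second. *)
Lemma homogeneous_extend U A (f g : A -> U) :
  homogeneous U -> finitely_generated A -> embedding f -> embedding g ->
  exists2 b : U -> U, isomorphism b & forall x, b (f x) = g x.
Proof.
move=> Uh Afg fe ge.
have [f' f'i f'E] := range_isomorphism _ _ _ fe.
have [g' g'i g'E] := range_isomorphism _ _ _ ge.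
have [h [hi f'K hK]] := isomorphism_inv _ _ _ f'i.
have fgR B (k : A -> B) : isomorphism k -> finitely_generated B.
  by move=> [ke kb]; apply: (fg_image _ _ k) => //; apply: bijective_surj.
have [b bi bE] := Uh _ _ (g' \o h) (fgR _ _ f'i) (fgR _ _ g'i) (isomorphism_comp _ _ _ _ _ hi g'i).
by exists b => // x; rewrite -f'E bE /= f'K g'E.
Qed.

Lemma homogeneous_retract U (k : U -> U) (F : set U) :
  homogeneous U -> embedding k -> finite_set F ->
  exists2 b : U -> U, isomorphism b & forall x, F x -> b (k x) = x.
Proof.
move=> Uh ke Ffin; have := sub_embedding U (Substructure (generated_closed U F)).
set S := Substructure _ => Se.
have [b bi bE] := homogeneous_extend _ _ _ _ Uh (fg_generated _ _ Ffin)
  (embedding_comp _ _ _ _ _ Se ke) Se.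
exists b => // x Fx; have Sx : generated F x by apply: sub_gen_smallest.
exact: bE (exist _ x Sx : S).
Qed.

(** [W] is the union of finitely generated substructures [A n], each embeddable into [U]. Correcting
    these embeddings by automorphisms of [U] makes each extend the previous one. *)
Lemma countable_universal U W : homogeneous U -> inhabited W ->
  sigma (age U) W -> exists h : W -> U, embedding h.
Proof.
move=> Uh [w0] [Wc Wage]; have [e eP] := countable_surj w0 Wc.
pose A n := Substructure (generated_closed W (e @` `I_n)).
have Afg n : finitely_generated (A n).
  by apply: fg_generated; apply: finite_image; apply: finite_II.
have Ae n : embedding (sval : A n -> W) := sub_embedding W (A n).
have /(_ _)/cid J n : exists h : A n -> U, embedding h.
  suff [] : age U (A n) by [].
  by apply: Wage; split=> //; exists sval.
have Am n x : generated (e @` `I_n) x -> generated (e @` `I_n.+1) x.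
  apply: smallest_sub; first exact: generated_closed.
  by move=> _ [m /= mn <-]; apply: sub_gen_smallest; exists m => //=; apply: ltnW.
pose inc n (x : A n) : A n.+1 := exist _ (sval x) (Am n _ (svalP x)).
have ince n : embedding (inc n) by apply: (embedding_cancel _ _ _ (inc n) sval (Ae n.+1) (Ae n)).
(* From a correction of [J n], homogeneity gives a correction of [J n.+1] that agrees with it on
   [A n]; [id] is a default outside the automorphisms. *)
have /choice[stp stpP] : forall na : nat * (U -> U), exists b, isomorphism na.2 ->
    isomorphism b /\ forall x, b (sval (J na.1.+1) (inc _ x)) = na.2 (sval (J na.1) x).
  move=> [n a] /=; have [ai|nai] := pselect (isomorphism a); last by exists id.
  have [b bi bE] := homogeneous_extend _ _ _ _ Uh (Afg n)
    (embedding_comp _ _ _ _ _ (ince n) (svalP (J n.+1)))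
    (embedding_comp _ _ _ _ _ (svalP (J n)) (proj1 ai)).
  by exists b.
pose fix al n := if n is m.+1 then stp (m, al m) else id.
have ali n : isomorphism (al n).
  elim: n => [|n IH]; last by have [] := stpP (n, al n) IH.
  exact: isomorphism_id.
have alS n x : al n.+1 (sval (J n.+1) (inc _ x)) = al n (sval (J n) x).
  by have [_ bE] := stpP (n, al n) (ali n); apply: bE.
pose q n (x : A n) := al n (sval (J n) x).
have AI n : injective (sval : A n -> W) by have [] := Ae n.
have sub m n : m <= n -> forall (x : A m) (y : A n), sval x = sval y -> q m x = q n y.
  elim: n => [|n IH]; first by rewrite leqn0 => /eqP-> x y /AI->.
  rewrite leq_eqVlt => /orP[/eqP->|mn] x y xy; first by move/AI: xy->.
  have Anx : generated (e @` `I_n) (sval x).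
    move: (svalP x); apply: sub_smallest2r; first exact: generated_closed.
    by move=> _ [k /= km <-]; exists k => //=; apply: leq_trans km mn.
  rewrite (IH mn x (exist _ _ Anx)) // /q -alS; congr al; congr (sval (J _) _).
  exact: AI.
have cov w : exists n (x : A n), sval x = w.
  have [n <-] := eP w; exists n.+1.
  have wA : generated (e @` `I_n.+1) (e n) by apply: sub_gen_smallest; exists n => /=.
  by exists (exist _ _ wA).
have [|h hE] := glue_fun (fun n => sval : A n -> W) q cov.
  move=> m n x y xy; have [mn|/ltnW nm] := leqP m n; first exact: sub.
  by apply/esym; apply: sub.
exists h; apply: (glue_embedding _ _ (fun n => sval : A n -> W) _ (inhabits 0)) => //.
  move=> n; apply: (@embedding_ext _ _ _ (q n)); first by move=> x; rewrite /= hE.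
  exact: embedding_comp (svalP (J n)) (proj1 (ali n)).
have sAm m n : m <= n -> range (sval : A m -> W) `<=` range (sval : A n -> W).
  move: m n; apply: (chain_mono (fun X Y : set W => X `<=` Y) (fun n => range (sval : A n -> W))).
  - by move=> X x.
  - by move=> X Y Z XY YZ; apply: subset_trans YZ.
  - by move=> n _ [x _ <-]; exists (inc n x).
by move=> m n; exists (maxn m n); split; apply: sAm; rewrite ?leq_maxl ?leq_maxr.
Qed.

End Homogeneity.

(** * Amalgamation of self-embeddings and their direct limits *)

Section Colimits.
Context {L : language}.
Implicit Types M N A B D U W : structure L.

(** An Ore condition on the monoid of self-embeddings. *)
Definition has_amalgamation U := forall f g : U -> U, embedding f -> embedding g ->
  exists f' g' : U -> U, [/\ embedding f', embedding g' & forall x, f' (f x) = g' (g x)].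

(** The amalgam of two self-embeddings is a countable structure [W], which goes back into [U] by
    [countable_universal]. *)
Lemma base_has_amalgamation U : homogeneous U -> inhabited U -> countable [set: U] ->
  amalgamation_base (sigma (age U)) U -> has_amalgamation U.
Proof.
move=> Uh [u0] Uc Ub f g fe ge.
have US : sigma (age U) U by split.
have [W [f' [g' [WS f'e g'e fg]]]] := Ub U U f g US US fe ge.
have [|h he] := countable_universal U W Uh _ WS; first exact: inhabits (f' u0).
exists (h \o f'), (h \o g'); split; [exact: embedding_comp..|move=> x /=].
by congr h; have := congr1 (@^~ x) fg.
Qed.

Lemma transit_embedding U (k : nat -> U -> U) n m :
  (forall i, embedding (k i)) -> embedding (transit k n m).
Proof.
move=> ke; elim: m => /= [|m IH]; first exact: embedding_id.
by case: leqP => _; [apply: embedding_comp|apply: embedding_id].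
Qed.

(* The colimit is obtained as [i n = lim_m (a m \o transit k n m)] with
   automorphisms [a m] such that [a m.+1 \o k m] agrees with [a m] on a finite
   set [F m]; these sets eventually capture every point and contain a preimage
   of every point. *)
Lemma homogeneous_colimit U (k : nat -> U -> U) :
  homogeneous U -> countable [set: U] -> inhabited U -> (forall n, embedding (k n)) ->
  exists i : nat -> U -> U, [/\ forall n, embedding (i n),
    forall n x, i n.+1 (k n x) = i n x & forall y, exists n x, i n x = y].
Proof.
move=> Uh Uc [u0] ke; have [e eP] := countable_surj u0 Uc.
have /choice[r rP] : forall kF : (U -> U) * set U, exists b : U -> U,
    embedding kF.1 -> finite_set kF.2 ->
    isomorphism b /\ forall x, kF.2 x -> b (kF.1 x) = x.
  move=> [k0 F] /=; have [[k0e Ff]|nk] := pselect (embedding k0 /\ finite_set F).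
    by have [b bi bE] := homogeneous_retract _ _ _ Uh k0e Ff; exists b.
  by exists id => k0e Ff; case: nk.
(* [seen] brings every point of every copy into [F] at some time; [hit] brings in the point sent to
   [e m], for joint surjectivity. Carrying [F] along by [k m] keeps the values already fixed. *)
pose seen m := [set transit k n m (e j) | n in `I_m.+1 & j in `I_m.+1].
pose hit (a : U -> U) m := [set x | a x = e m].
pose step m (aF : (U -> U) * set U) := let a' := aF.1 \o r (k m, aF.2) in
  (a', k m @` aF.2 `|` (seen m.+1 `|` hit a' m.+1)).
pose fix st m := if m is n.+1 then step n (st n) else (id, seen 0 `|` hit id 0).
pose a m := (st m).1; pose F m := (st m).2.
have seenf m : finite_set (seen m) by apply: finite_image2; apply: finite_II.
have hitf b m : isomorphism b -> finite_set (hit b m).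
  move=> [[bI _ _] _]; apply: (@finite_preimage _ _ [set e m] b) => //.
  by move=> x y _ _; apply: bI.
have idi := isomorphism_id U.
have aF m : isomorphism (a m) /\ finite_set (F m).
  elim: m => [|m [ai Ff]]; first by rewrite /a /F /= finite_setU; do !split => //; apply: hitf.
  have [bi _] := rP (k m, F m) (ke m) Ff.
  have ai' : isomorphism (a m.+1) by apply: isomorphism_comp.
  split=> //; rewrite /F /= !finite_setU; do !split => //; first exact: finite_image.
  exact: hitf.
have aS m x : F m x -> a m.+1 (k m x) = a m x.
  by move=> Fx; rewrite /a /=; have [_ ->] := rP (k m, F m) (ke m) (proj2 (aF m)).
have FS m x : F m x -> F m.+1 (k m x) by move=> Fx; left; exists x.
have Fseen m : seen m `<=` F m by case: m => [|m] x ?; [left|right; left].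
have Fhit m : hit (a m) m `<=` F m by case: m => [|m] x ?; right => //; right.
(* Once the orbit of [x] has entered [F], it stays there and its value under [a] no longer
   changes. *)
have stable m m' n x : n <= m -> m <= m' -> F m (transit k n m x) ->
    F m' (transit k n m' x) /\ a m' (transit k n m' x) = a m (transit k n m x).
  move=> nm; elim: m' => [|m' IH]; first by rewrite leqn0 => /eqP->.
  rewrite leq_eqVlt => /orP[/eqP->//|mm'] Fx; have [F' a'] := IH mm' Fx.
  rewrite transitS; last exact: leq_trans nm mm'.
  by split; [apply: FS|rewrite aS].
have evF n x : exists2 m, n <= m & F m (transit k n m x).
  have [j <-] := eP x; exists (maxn n j); first exact: leq_maxl.
  by apply: Fseen; exists n; [|exists j => //]; rewrite /= ltnS ?leq_maxl ?leq_maxr.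
have /choice[i0 i0P] : forall nx : nat * U, exists y, exists2 m, nx.1 <= m &
    forall m', m <= m' -> a m' (transit k nx.1 m' nx.2) = y.
  move=> [n x]; have [m nm Fx] := evF n x; exists (a m (transit k n m x)), m => // m' mm'.
  by have [] := stable m m' n x nm mm' Fx.
pose i n x := i0 (n, x).
have iP n x : exists2 m, n <= m & forall m', m <= m' -> a m' (transit k n m' x) = i n x.
  exact: i0P (n, x).
exists i; split=> [n|n x|y].
- apply: embedding_local => G Gf.
  pose P m := [set x | forall m', m <= m' -> a m' (transit k n m' x) = i n x].
  have [m mP] : exists m, G `<=` P m.
    apply: finite_cover Gf; first exact: inhabits 0.
      move=> s t; exists (maxn s t).
      by split=> x /= sx m'; rewrite geq_max => /andP[] *; apply: sx.
    by move=> x; have [m _ ?] := iP n x; exists m.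
  exists U, id, (a m \o transit k n m); split; first exact: embedding_id.
    by apply: embedding_comp; [apply: transit_embedding|have [[]] := aF m].
  by move=> x /mP /(_ _ (leqnn m)) <-; exists x.
- have [m nm mP] := iP n x; have [m' nm' m'P] := iP n.+1 (k n x).
  rewrite -(mP (maxn m m')) ?leq_maxl // -(m'P (maxn m m')) ?leq_maxr //.
  by rewrite -transit_first //; apply: leq_trans nm' _; apply: leq_maxr.
- have [m <-] := eP y; have [[_ /bijective_surj/(_ (e m))[x ax]] _] := aF m.
  have Fx : F m (transit k m m x) by rewrite transit_id //; apply: Fhit.
  exists m, x; have [m' mm' m'P] := iP m x; rewrite -(m'P m') //.
  by have [_ ->] := stable m m' m x (leqnn m) mm' Fx; rewrite transit_id.
Qed.

End Colimits.

(** * Extending automorphisms along a non-surjective self-embedding *)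

Section Extension.
Context {L : language}.
Implicit Types M N A B D U W : structure L.

(** The universal property of the direct limit, for embeddings. *)
Lemma cocone_glue U M N (k : nat -> U -> U) (i : nat -> U -> M) (q : nat -> U -> N) :
  (forall n, embedding (i n)) -> (forall n, embedding (q n)) ->
  (forall n x, i n.+1 (k n x) = i n x) ->
  (forall n x, q n.+1 (k n x) = q n x) -> (forall y, exists n x, i n x = y) ->
  exists2 g : M -> N, embedding g & forall n x, g (i n x) = q n x.
Proof.
move=> ie qe ik qk cov.
have [|g gE] := cocone_glue_fun k i q _ ik qk cov; first by move=> n; have [] := ie n.
exists g => //; apply: (glue_embedding _ _ i _ (inhabits 0)) => //.
  by move=> n; apply: embedding_ext (qe n) => x; rewrite /= gE.
have ri m n : m <= n -> range (i m) `<=` range (i n).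
  by move=> mn _ [x _ <-]; rewrite -(transit_cocone k i _ n x ik mn); exists (transit k m n x).
by move=> m n; exists (maxn m n); split; apply: ri; rewrite ?leq_maxl ?leq_maxr.
Qed.

Section Amalgamation.
Context {U : structure L}.
Context (Uh : homogeneous U) (Uc : countable [set: U]) (U0 : inhabited U).
Context (Ua : has_amalgamation U).

(** The [p j] are amalgamated one after the other with the composite [c j] of [k] and the maps found
    so far. The limit of this sequence receives all the amalgams, and [k'] is the map [i 0] into
    it. *)
Lemma amalgamate_sequence (k : U -> U) (p : nat -> U -> U) :
  embedding k -> (forall j, embedding (p j)) ->
  exists (k' : U -> U) (p' : nat -> U -> U), [/\ embedding k',
    forall j, embedding (p' j) & forall j x, p' j (p j x) = k' (k x)].
Proof.
move=> ke pe.
have /choice[am amP] : forall fg : (U -> U) * (U -> U), exists fg' : (U -> U) * (U -> U),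
    embedding fg.1 -> embedding fg.2 ->
    [/\ embedding fg'.1, embedding fg'.2 & forall x, fg'.1 (fg.1 x) = fg'.2 (fg.2 x)].
  move=> [f g] /=; have [[fe ge]|nfg] := pselect (embedding f /\ embedding g).
    by have [f' [g' ?]] := Ua f g fe ge; exists (f', g').
  by exists (id, id) => fe ge; case: nfg.
pose fix c n := if n is m.+1 then (am (p m, c m)).2 \o c m else k.
have ce n : embedding (c n).
  elim: n => //= n IH; have [_ me _] := amP (p n, c n) (pe n) IH.
  exact: embedding_comp.
have me n : embedding (am (p n, c n)).2 by have [] := amP (p n, c n) (pe n) (ce n).
have [i [ie ik _]] := homogeneous_colimit U (fun n => (am (p n, c n)).2) Uh Uc U0 me.
have ic n x : i n (c n x) = i 0 (k x) by elim: n => //= n <-; rewrite ik.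
exists (i 0), (fun j => i j.+1 \o (am (p j, c j)).1); split=> [//|j|j x /=].
  by apply: embedding_comp; have [] := amP (p j, c j) (pe j) (ce j).
have [_ _ E] := amP (p j, c j) (pe j) (ce j).
by rewrite E /= ik ic.
Qed.

(* Modulo the maps [k], each [p n.+2] extends [p n] and each [p n.+1] extends the
   inverse of [p n]; the even steps have union [g], the odd steps its inverse. *)
Lemma ladder_automorphism (k p i : nat -> U -> U) :
  (forall n, embedding (p n)) -> (forall n, embedding (i n)) ->
  (forall n x, p n.+1 (p n x) = k n.+1 (k n x)) ->
  (forall n x, i n.+1 (k n x) = i n x) -> (forall y, exists n x, i n x = y) ->
  exists2 g : U -> U, isomorphism g & forall x, g (i 0 x) = i 1 (p 0 x).
Proof.
move=> pe ie pp ik cov.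
have halfO n : odd n -> n./2.*2.+1 = n by move=> no; rewrite -[RHS]odd_double_half no.
have halfE n : ~~ odd n -> n./2.*2 = n by exact: even_halfK.
have [|||||g ge gE] := cocone_glue U U U (fun m => k m.*2.+1 \o k m.*2)
  (fun m => i m.*2) (fun m => i m.*2.+1 \o p m.*2).
- by move=> n; apply: ie.
- by move=> n; apply: embedding_comp.
- by move=> n x; rewrite /= doubleS !ik.
- by move=> n x; rewrite /= doubleS -pp pp !ik.
(* The even copies are cofinal: a point of an odd copy moves one copy further. *)
- move=> y; have [n [x <-]] := cov y; case: (boolP (odd n)) => no.
    by exists n./2.+1, (k n x); rewrite /= doubleS halfO // ik.
  by exists n./2, x; rewrite /= halfE.
exists g; last exact: (gE 0).
apply: isomorphism_surj => // y; have [n [x <-]] := cov y.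
have [m [z <-]] : exists m z, i m.*2.+1 z = i n x.
  case: (boolP (odd n)) => no.
    by exists n./2, x; rewrite halfO.
  by exists n./2, (k n x); rewrite halfE // ik.
(* The odd step [p m.*2.+1] gives the preimage, since [p m.*2.+2] undoes it modulo the maps [k]. *)
exists (i m.+1.*2 (p m.*2.+1 z)); rewrite gE /= doubleS.
by rewrite pp !ik.
Qed.

(** Starting from [e] and the maps [e \o h j], repeated amalgamation gives one ladder for each [j],
    all over the same sequence of maps. With its limit [i], the ladders yield [g j] with [g j \o i 0
    = i 1 \o e \o h j = i 0 \o h j]. So [k] is [i 0 = i 1 \o e], which misses [i 1 y]. *)
Lemma extend_automorphisms (h : nat -> U -> U) :
  (exists2 e : U -> U, embedding e & exists y, forall x, e x <> y) ->
  (forall n, isomorphism (h n)) ->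
  exists (k : U -> U) (g : nat -> U -> U), [/\ embedding k, exists y, forall x, k x <> y,
    forall n, isomorphism (g n) & forall n x, g n (k x) = k (h n x)].
Proof.
move=> [e ee [y ey]] hi.
pose good (kp : (U -> U) * (nat -> U -> U)) := embedding kp.1 /\ forall n, embedding (kp.2 n).
have /choice[st stP] : forall kp : (U -> U) * (nat -> U -> U), exists kp', good kp ->
    good kp' /\ forall j x, kp'.2 j (kp.2 j x) = kp'.1 (kp.1 x).
  move=> [k p]; have [[ke pe]|nkp] := pselect (good (k, p)).
    by have [k' [p' [k'e p'e E]]] := amalgamate_sequence k p ke pe; exists (k', p').
  by exists (k, p) => ?; case: nkp.
pose s n := iter n st (e, fun j => e \o h j).
have sg n : good (s n).
  elim: n => [|n IH]; last by have [] := stP _ IH.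
  by split=> // n; apply: embedding_comp => //; have [] := hi n.
have [i [ie ik cov]] := homogeneous_colimit U (fun n => (s n).1) Uh Uc U0 (fun n => proj1 (sg n)).
have /choice[g gP] : forall j, exists g : U -> U, isomorphism g /\
    forall x, g (i 0 x) = i 1 (e (h j x)).
  move=> j; have [|//|||//|g gi gE] := ladder_automorphism (fun n => (s n).1) (fun n => (s n).2 j) i.
  - by move=> n; have [_] := sg n.
  - by move=> n x; have [_] := stP _ (sg n); apply.
  - by [].
  by exists g.
exists (i 0), g; split=> [//||n|n x]; last 2 first.
- by have [] := gP n.
- by have [_ ->] := gP n; apply: (ik 0).
exists (i 1 y) => x; rewrite -ik => /= E; apply: (ey x).
by have [iI _ _] := ie 1; apply: iI.
Qed.
End Amalgamation.

End Extension.

(** * Copies of the structure in a fixed set *)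

Definition map_pair {X Y : Type} (f : X -> Y) (x : X * X) : Y * Y := (f x.1, f x.2).

Lemma map_pair_inj {X Y : Type} (f : X -> Y) : injective f -> injective (map_pair f).
Proof. by move=> fI [x x'] [y y'] [/fI-> /fI->]. Qed.

Definition solves {X : Type} (h : X -> X) (c : seq (X * X)) : Prop :=
  forall x, x \in (c : seq {classic X * X}) -> h x.1 = x.2.

Lemma solves_map {X Y : Type} (k : X -> Y) (h : X -> X) (g : Y -> Y) (c : seq (X * X)) :
  (forall x, g (k x) = k (h x)) -> solves h c -> solves g (map (map_pair k) c).
Proof.
move=> gk hc y /(@mapP {classic X * X} {classic Y * Y})[x xc ->].
by rewrite /= gk hc.
Qed.

Section Copies.
Context {L : language}.
Implicit Types M N A B D U W : structure L.

(** For homogeneous [U], these are the graphs of finite maps that extend to an isomorphism between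
    finitely generated substructures. *)
Definition solvable U (c : seq (U * U)) : Prop :=
  exists2 h : U -> U, isomorphism h & solves h c.

(** On the finitely many points of [c], [k] agrees with the inverse of an automorphism [b];
    conjugating the solution by [b] solves [c]. *)
Lemma solvable_map U (k : U -> U) (c : seq (U * U)) : homogeneous U ->
  embedding k -> solvable U (map (map_pair k) c) -> solvable U c.
Proof.
move=> Uh ke [h hi hc].
pose X := [set` (c : seq {classic U * U})] : set (U * U).
have Xf : finite_set X by exact: (@finite_seq {classic U * U} c).
have [|b bi bE] := homogeneous_retract _ k (fst @` X `|` snd @` X) Uh ke.
  by rewrite finite_setU; split; apply: finite_image.
have [b' [b'i bK b'K]] := isomorphism_inv _ _ _ bi.
exists (b \o (h \o b')); first by do 2!apply: isomorphism_comp => //.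
move=> x xc /=.
have E1 : b (k x.1) = x.1 by apply: bE; left; exists x.
have E2 : b (k x.2) = x.2 by apply: bE; right; exists x.
rewrite -{1}E1 bK; have := hc (map_pair k x).
by rewrite /= => -> //; apply: (@map_f {classic U * U} {classic U * U}).
Qed.

Section Stages.
Context {U : structure L} {O : Type}.

(* A copy of [U] inside [O], together with an automorphism realizing each finite
   partial isomorphism of that copy; such a partial isomorphism is listed by its
   graph, a sequence of pairs of points of [O]. *)
Record stage := Stage {
  place : U -> O;
  act : seq (O * O) -> U -> U;
  place_inj : injective place;
  act_iso : forall p, isomorphism (act p);
  act_solves : forall c, solvable U c -> solves (act (map (map_pair place) c)) c }.

(** Only lists of points of the copy [s] are compared, so [t] is free to choose its automorphisms
    for all other lists. *)
Definition stage_embedding (s t : stage) (k : U -> U) : Prop :=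
  [/\ embedding k, forall x, place s x = place t (k x) &
    forall c x, act t (map (map_pair (place s)) c) (k x) =
                k (act s (map (map_pair (place s)) c) x)].

Definition stage_le (s t : stage) : Prop := exists k, stage_embedding s t k.

Lemma stage_place_le s t k c : stage_embedding s t k ->
  map (map_pair (place s)) c = map (map_pair (place t)) (map (map_pair k) c).
Proof.
move=> [_ st _]; rewrite -map_comp; apply: eq_map => x.
by rewrite /= /map_pair /= !st.
Qed.

Lemma stage_le_refl s : stage_le s s.
Proof. by exists id; split=> //; apply: embedding_id. Qed.

Lemma stage_le_trans r s t : stage_le r s -> stage_le s t -> stage_le r t.
Proof.
move=> [k rs] [l st]; exists (l \o k).
have [ke kp ka] := rs; have [le lp la] := st.
split=> [|x|c x /=]; [exact: embedding_comp|by rewrite kp lp|].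
by rewrite -ka (stage_place_le _ _ _ c rs) la.
Qed.

Lemma stage_le_range s t : stage_le s t -> range (place s) `<=` range (place t).
Proof. by move=> [k [_ kp _]] _ [x _ <-]; rewrite kp; exists (k x). Qed.

(** Equal ranges make the connecting map bijective, and its inverse connects the stages the other
    way. Hence a strictly larger stage has new points. *)
Lemma stage_le_antisym s t : stage_le s t -> range (place t) `<=` range (place s) ->
  stage_le t s.
Proof.
move=> [k kst] ts; have [ke kp ka] := kst.
have ki : isomorphism k.
  apply: isomorphism_surj => // y; have [|x _ e] := ts (place t y); first by exists y.
  by exists x; apply: (place_inj t); rewrite -kp.
have [l [[le _] kK lK]] := isomorphism_inv _ _ _ ki.
have ls x : place t x = place s (l x) by rewrite kp lK.
exists l; split=> // c x.
have -> : map (map_pair (place t)) c = map (map_pair (place s)) (map (map_pair l) c).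
  by rewrite -map_comp; apply: eq_map => z; rewrite /= /map_pair /= !ls.
by rewrite -{2}(lK x) ka kK.
Qed.

Context (Uh : homogeneous U).

(** The index type allows a sequence (limits), a single stage (successors) and the empty family (a
    first stage). *)
Lemma stage_extend {T : Type} (s : T -> stage) (f : U -> O) (i : T -> U -> U) :
  injective f -> (forall n, embedding (i n)) ->
  (forall n x, place (s n) x = f (i n x)) ->
  (forall p, exists2 h : U -> U, isomorphism h & forall n c,
    p = map (map_pair (place (s n))) c -> forall x, h (i n x) = i n (act (s n) p x)) ->
  exists2 t, place t = f & forall n, stage_le (s n) t.
Proof.
move=> fI ie sf hex.
have fIm := inj_map (map_pair_inj f fI).
have /choice[a aP] : forall p, exists h : U -> U, [/\ isomorphism h,
    forall n c, p = map (map_pair (place (s n))) c ->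
      forall x, h (i n x) = i n (act (s n) p x)
    & forall c, p = map (map_pair f) c -> solvable U c -> solves h c].
  move=> p.
  have sE n c : map (map_pair (place (s n))) c = map (map_pair f) (map (map_pair (i n)) c).
    by rewrite -map_comp; apply: eq_map => z; rewrite /= /map_pair /= !sf.
  (* A list already present in some [s n] takes the given extension [h]. It still solves the list:
     by [solvable_map] the list is solvable in [s n], where [act] solves it. A new list takes any
     solution, or [id] if there is none. *)
  have [[n [c pc]]|np] := pselect (exists n c, p = map (map_pair (place (s n))) c).
    have [h hi hE] := hex p; exists h; split=> // d pd dsol.
    have cd : d = map (map_pair (i n)) c by apply: fIm; rewrite -pd pc sE.
    rewrite cd; apply: (solves_map (i n) (act (s n) p)); first exact: hE pc.
    rewrite pc; apply: act_solves; apply: (solvable_map _ (i n)) => //.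
    by rewrite -cd.
  have idi := isomorphism_id U.
  have [[c pc [h hi hc]]|nc] := pselect (exists2 c, p = map (map_pair f) c & solvable U c).
    exists h; split=> // [n d pd|d pd _]; first by case: np; exists n, d.
    by suff -> : d = c by []; apply: fIm; rewrite -pd.
  exists id; split=> // [n d pd|d pd dsol]; first by case: np; exists n, d.
  by case: nc; exists d.
have [ai an asol] : [/\ forall p, isomorphism (a p), forall p n c,
    p = map (map_pair (place (s n))) c -> forall x, a p (i n x) = i n (act (s n) p x)
    & forall c, solvable U c -> solves (a (map (map_pair f) c)) c].
  split=> [p|p|c]; [by have [] := aP p|by have [] := aP p|].
  by have [_ _] := aP (map (map_pair f) c); apply.
exists (Stage f a fI ai asol) => // n; exists (i n); split=> // c x.
exact: an.
Qed.

Context (Uc : countable [set: U]) (U0 : inhabited U).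

(** The new copy is the direct limit. A list present from stage [n0] on has automorphisms
    [act (s n) p] that commute with the connecting maps for [n >= n0], and these glue. *)
Lemma stage_limit (s : nat -> stage) : (forall n, stage_le (s n) (s n.+1)) ->
  exists t, forall n, stage_le (s n) t.
Proof.
move=> /choice[k kP].
have ke n : embedding (k n) by have [] := kP n.
have [i [ie ik cov]] := homogeneous_colimit U k Uh Uc U0 ke.
have iI n : injective (i n) by have [] := ie n.
have [|f fE] := cocone_glue_fun k i (fun n => place (s n)) iI ik _ cov.
  by move=> n x; have [_ ->] := kP n.
have cov2 m n : exists r, forall x y, exists x' y', [/\ i m x = i r x' & i n y = i r y'].
  exists (maxn m n) => x y; exists (transit k m (maxn m n) x), (transit k n (maxn m n) y).
  by rewrite !(transit_cocone k i) ?leq_maxl ?leq_maxr.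
have fI : injective f.
  move=> x y; have [m [x' <-]] := cov x; have [n [y' <-]] := cov y.
  have [r /(_ x' y')[x2 [y2 [-> ->]]]] := cov2 m n.
  by rewrite !fE => /place_inj->.
have [p|t _ tP] := stage_extend s f i fI ie (fun n x => esym (fE n x)); last by exists t.
have [exn|nex] := pselect (exists n, `[< exists c, p = map (map_pair (place (s n))) c >]);
    last first.
  exists id; first exact: isomorphism_id.
  by move=> n c pc; case: nex; exists n; apply/asboolP; exists c.
have [n0 /asboolP pn0 nmin] := ex_minnP exn.
have pn d : exists c, p = map (map_pair (place (s (d + n0)))) c.
  elim: d => // d [c ->]; exists (map (map_pair (k (d + n0))) c).
  exact: stage_place_le (kP (d + n0)).
have iS d x : i (d + n0).+1 (k (d + n0) x) = i (d + n0) x by exact: ik.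
have covn y : exists d x, i (d + n0) x = y.
  have [n [x <-]] := cov y; exists n, (transit k n (n + n0) x).
  by rewrite (transit_cocone k i) // leq_addr.
have [|||||h he hE] := cocone_glue U U U (fun d => k (d + n0)) (fun d => i (d + n0))
  (fun d => i (d + n0) \o act (s (d + n0)) p) => //.
- by move=> d; apply: embedding_comp; have [] := act_iso (s (d + n0)) p.
- move=> d x; have [c pc] := pn d; have [_ _ ka] := kP (d + n0).
  by rewrite addSn /= {1}pc ka -pc ik.
exists h.
  apply: isomorphism_surj => // y; have [d [x <-]] := covn y.
  have [_ /bijective_surj/(_ x)[z <-]] := act_iso (s (d + n0)) p.
  by exists (i (d + n0) z); rewrite hE.
move=> n c pc x; have n0n : n0 <= n by apply: nmin; apply/asboolP; exists c.
by have := hE (n - n0) x; rewrite subnK.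
Qed.

Context (Ua : has_amalgamation U) (Ounc : ~ countable [set: O]).
Context (Ue : exists2 e : U -> U, embedding e & exists y, forall x, e x <> y).

(** There are countably many lists over [U], so [extend_automorphisms] handles all automorphisms of
    [s] with a single [k]; the points outside the range of [k] become new points of [O]. *)
Lemma stage_succ (s : stage) :
  exists2 t, stage_le s t & ~ range (place t) `<=` range (place s).
Proof.
case: U0 => u0; have [e eP] := countable_surj u0 Uc.
have /choice[r rP] := eP.
(* An enumeration of all lists over [U], through codes of lists over [nat]; the empty list is the
   default for invalid codes. *)
pose cs n : seq (U * U) := if @unpickle (seq (nat * nat)) n is Some l
  then map (map_pair e) l else [::].
have csP c : exists n, cs n = c.
  exists (pickle (map (map_pair r) c)); rewrite /cs pickleK -map_comp -[RHS]map_id.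
  by apply: eq_map => -[x y]; rewrite /= /map_pair /= !rP.
have [k [g [ke [y ky] gi gk]]] := extend_automorphisms Uh Uc U0 Ua
  (fun n => act s (map (map_pair (place s)) (cs n))) Ue (fun n => act_iso s _).
have kI : injective k by have [] := ke.
have [j jI js] : exists2 j : U -> O, injective j & forall x, ~ range (place s) (j x).
  have rc : countable (range (place s)) := sub_countable (card_image_le _ _) Uc.
  have [j jI js] := countable_avoid _ _ Uc rc Ounc.
  by exists j => // x x'; apply: jI.
(* On the range of [k] the old places are kept; elsewhere [j] gives places outside the copy [s]. *)
have /choice[f fP] : forall z, exists w, (forall x, z = k x -> w = place s x) /\
    ((forall x, z <> k x) -> w = j z).
  move=> z; have [[x ->]|nz] := pselect (exists x, z = k x).
    by exists (place s x); split=> [x' /kI->//|/(_ x)].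
  by exists (j z); split=> // x zx; case: nz; exists x.
have fk x : f (k x) = place s x by have [fkx _] := fP (k x); exact: fkx.
have fj z : (forall x, z <> k x) -> f z = j z by have [_] := fP z.
have fI : injective f.
  move=> z z'; have [[x ->]|/forallNP nz] := pselect (exists x, z = k x);
    have [[x' ->]|/forallNP nz'] := pselect (exists x, z' = k x).
  - by rewrite !fk => /place_inj->.
  - by rewrite fk (fj z') // => E; case: (js z'); exists x.
  - by rewrite fk (fj z) // => E; case: (js z); exists x'.
  - by rewrite !fj // => /jI.
have [||t tf /(_ tt) st] := stage_extend (fun _ : unit => s) f (fun=> k) fI (fun=> ke).
- by move=> _ x; rewrite fk.
- move=> p; have [[c pc]|nc] := pselect (exists c, p = map (map_pair (place s)) c).
    have [n cn] := csP c; exists (g n) => // _ c' _ x.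
    by rewrite gk cn -pc.
  exists id; first exact: isomorphism_id.
  by move=> _ c pc; case: nc; exists c.
exists t => // sub; apply: (js y).
rewrite -fj; last by move=> x E; apply: (ky x).
by apply: sub; exists y => //; rewrite tf.
Qed.

Lemma stage_exists : inhabited stage.
Proof.
have c0 : countable (@set0 O) by exact: countable0.
have [j jI _] := countable_avoid _ _ Uc c0 Ounc.
have [||||t _ _] := stage_extend (fun f : False => match f with end) j
  (fun f : False => match f with end) => //.
- by move=> x y; apply: jI.
- move=> p; exists id => //.
  exact: isomorphism_id.
Qed.

Lemma stage_chain : exists C : set stage, [/\ total_on C stage_le, C !=set0 &
  forall s : nat -> stage, (forall n, C (s n)) ->
    exists2 t, C t & forall n, stage_le (s n) t /\ ~ stage_le t (s n)].
Proof.
apply: Zorn_strict_chain; first exact: stage_exists.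
- exact: stage_le_refl.
- by move=> r s t; apply: stage_le_trans.
(* The limit bounds the sequence, and a successor of it adds a point, which makes the bound
   strict. *)
move=> s /stage_limit[u uP]; have [t ut tu] := stage_succ u.
exists t => n; split; first exact: stage_le_trans (uP n) ut.
move=> /stage_le_range ts; apply: tu => x /ts.
exact: (stage_le_range _ _ (uP n)).
Qed.

End Stages.

End Copies.

(** * The union of a chain of copies *)

Section Union.
Context {L : language}.
Implicit Types M N A B D U W : structure L.

(** A tuple of [X] has finitely many entries, hence comes from one copy, where the symbols are
    interpreted. [common] shows that the copy does not matter. *)
Lemma colimit_structure U {T X : Type} (i : T -> U -> X) :
  inhabited T -> (forall s, injective (i s)) -> (forall x, exists s y, i s y = x) ->
  (forall s t, exists r (a b : U -> U), [/\ embedding a, embedding b,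
    forall x, i s x = i r (a x) & forall x, i t x = i r (b x)]) ->
  exists (F : forall f : fun_sym L, (fun_arity f).-tuple X -> X)
    (R : forall r : rel_sym L, set ((rel_arity r).-tuple X)),
  forall s, @embedding L U (Structure F R) (i s).
Proof.
move=> T0 iI cov dir.
have cover n (t : n.-tuple X) : exists s x, t = map_tuple (i s) x.
  have [|||s /tuple_range[x ->]] := finite_cover (fun s => range (i s)) T0 _ _
    [set tnth t j | j in [set: 'I_n]].
  - move=> s u; have [r [a [b [_ _ ia ib]]]] := dir s u; exists r; split=> _ [x _ <-].
      by rewrite ia; exists (a x).
    by rewrite ib; exists (b x).
  - by move=> x; have [s [y <-]] := cov x; exists s, y.
  - exact: finite_image.
  by exists s, x.
have common n s t (x y : n.-tuple U) : map_tuple (i s) x = map_tuple (i t) y ->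
    exists r (a b : U -> U), [/\ embedding a, embedding b, i s =1 i r \o a, i t =1 i r \o b
      & map_tuple a x = map_tuple b y].
  move=> xy; have [r [a [b [ae be ia ib]]]] := dir s t; exists r, a, b; split=> //.
  apply: (map_tuple_inj (i r)) => //; rewrite !map_tuple_comp.
  transitivity (map_tuple (i s) x).
    by apply: eq_from_tnth => j; rewrite !tnth_map /= ia.
  by rewrite xy; apply: eq_from_tnth => j; rewrite !tnth_map /= ib.
have /(_ _)/cid F f : exists F : (fun_arity f).-tuple X -> X,
    forall s x, F (map_tuple (i s) x) = i s (fun_interp x).
  have /choice[F FP] : forall t : (fun_arity f).-tuple X, exists z, exists s x,
      t = map_tuple (i s) x /\ z = i s (fun_interp x).
    by move=> t; have [s [x ->]] := cover _ t; exists (i s (fun_interp x)), s, x.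
  exists F => s x; have [t [y [/common[r [a [b [ae be ia ib ab]]]] ->]]] := FP (map_tuple (i s) x).
  have [_ aF _] := ae; have [_ bF _] := be.
  by rewrite ia ib /= aF bF ab.
exists (fun f => sval (F f)), (fun r => [set t | exists s x, t = map_tuple (i s) x /\ rel_interp x]).
move=> s; split=> [//|f x|r x] /=; first by rewrite (svalP (F f)).
split=> [rx|[t [y [/common[q [a [b [ae be ia ib ab]]]] ry]]]]; first by exists s, x.
have [_ _ aR] := ae; have [_ _ bR] := be.
by rewrite aR ab -bR.
Qed.

(** The generators of [A] and their images under [h] lie in one copy [s]. There [h] is given by a
    finite list, and the automorphisms assigned to this list in the copies above [s] glue to one of
    [M]. *)
Lemma stages_homogeneous U (M : structure L) {O T : Type} (st : T -> @stage L U O)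
    (i : T -> U -> M) (v : M -> O) : homogeneous U ->
  injective v -> (forall t x, v (i t x) = place (st t) x) ->
  (forall t, embedding (i t)) ->
  (forall s t, stage_le (st s) (st t) \/ stage_le (st t) (st s)) ->
  (forall F : set M, finite_set F -> exists s, F `<=` range (i s)) ->
  homogeneous M.
Proof.
move=> Uh vI vi ie tot fin A B h Afg Bfg [he hb].
have [X [Xf gX]] := Afg.
have Ae := sub_embedding M A; have he' := embedding_comp _ _ _ _ _ he (sub_embedding M B).
have [|s sP] := fin ((sval : A -> M) @` X `|` ((sval : B -> M) \o h) @` X).
  by rewrite finite_setU; split; apply: finite_image.
have [|f fe fE] := lift_embedding A U M _ (i s) Ae (ie s).
  by apply: generated_range gX Ae (ie s) _ => x Xx; apply: sP; left; exists x.
have [|g ge gE] := lift_embedding A U M _ (i s) he' (ie s).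
  by apply: generated_range gX he' (ie s) _ => x Xx; apply: sP; right; exists x.
have [b bi bE] := homogeneous_extend U A f g Uh Afg fe ge.
have [l lX] := finite_list X Xf.
(* The graph of [h] on the generators, read in the copy [s]. Since [b] solves it, so does
   [act (st s) p], which then agrees with [h] on all of [A]. *)
pose c : seq (U * U) := map (fun x => (f x, g x)) l.
pose p := map (map_pair (place (st s))) c.
have actfg x : act (st s) p (f x) = g x.
  apply: (generated_embedding_eq _ _ (act (st s) p \o f) g X gX) => //.
    by apply: embedding_comp => //; have [] := act_iso (st s) p.
  move=> y; rewrite lX /= => yl.
  have csol : solvable U c.
    by exists b => // z /(@mapP {classic A} {classic U * U})[w wl ->]; rewrite /= bE.
  apply: (act_solves (st s) c csol (f y, g y)).
  exact: (@map_f {classic A} {classic U * U} (fun x => (f x, g x))).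
(* In a copy above [s], [p] is again a list of its points, so the actions on [p] are compatible;
   these copies still cover [M]. *)
pose T' := {t : T | stage_le (st s) (st t)}.
pose j (t : T') : U -> M := i (sval t).
have jr (t u : T') : stage_le (st (sval t)) (st (sval u)) -> exists k,
    [/\ stage_embedding (st (sval t)) (st (sval u)) k & forall x, j t x = j u (k x)].
  move=> [k ktu]; exists k; split=> // x; apply: vI; rewrite !vi.
  by have [_ ->] := ktu.
have pin (t : T') : exists d, p = map (map_pair (place (st (sval t)))) d.
  have [k kst] := svalP t; exists (map (map_pair k) c).
  exact: stage_place_le kst.
have cst (t u : T') x y : stage_le (st (sval t)) (st (sval u)) -> j t x = j u y ->
    j t (act (st (sval t)) p x) = j u (act (st (sval u)) p y).
  move=> /jr[k [[_ _ ka] jk]]; rewrite !jk.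
  have [uI _ _] := ie (sval u); move=> /uI <-.
  by have [d ->] := pin t; rewrite ka.
have lift x : exists t : T', exists2 y, j t y = x & True.
  have [|r rP] := fin [set x]; first exact: finite_set1.
  have [y _ <-] := rP x erefl.
  have [sr|rs] := tot s r; first by exists (exist _ r sr), y.
  have [k [_ kp _]] := rs; exists (exist _ s (stage_le_refl _)), (k y) => //.
  by apply: vI; rewrite !vi kp.
have [x|t u x y|G GE] := glue_fun j (fun t => j t \o act (st (sval t)) p).
- by have [t [y <-]] := lift x; exists t, y.
- have [tu|ut] := tot (sval t) (sval u); first exact: cst.
  by move=> e; apply/esym; apply: cst.
have ji (t : T') : embedding (j t \o act (st (sval t)) p).
  by apply: embedding_comp; [have [] := act_iso (st (sval t)) p|apply: ie].
exists G; last first.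
  move=> a; rewrite -fE; have -> : i s (f a) = j (exist _ s (stage_le_refl _)) (f a) by [].
  by rewrite GE /= actfg /j /= gE.
apply: isomorphism_surj; last first.
  move=> x; have [t [y <- _]] := lift x.
  have [_ /bijective_surj/(_ y)[z <-]] := act_iso (st (sval t)) p.
  by exists (j t z); rewrite GE.
apply: (glue_embedding _ _ j); first exact: inhabits (exist _ s (stage_le_refl _)).
- by move=> t; apply: ie.
- by move=> t; apply: embedding_ext (ji t) => x; rewrite /= GE.
- move=> t u; have [/jr[k [_ jk]]|/jr[k [_ jk]]] := tot (sval t) (sval u).
    by exists u; split=> // _ [x _ <-]; rewrite jk; exists (k x).
  by exists t; split=> // _ [x _ <-]; rewrite jk; exists (k x).
- by move=> x; have [t [y <- _]] := lift x; exists t, y.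
Qed.

End Union.

Theorem theorem1p1 (L : language) (U : structure L) :
  countable_language L ->
  countable [set: U] ->
  homogeneous U ->
  amalgamation_base (sigma (age U)) U ->
  Emb U <> Aut U ->
  exists M : structure L,
    [/\ homogeneous M, has_cardinality_aleph1 M
      & forall A : structure L, age M A <-> age U A].
Proof.
move=> _ Uc Uh Ub EA.
have Ue : exists2 e : U -> U, embedding e & exists y, forall x, e x <> y.
  apply: contrapT => ne; apply: EA; apply/seteqP; split=> e; last by case.
  move=> ee; apply: isomorphism_surj => // y; apply: contrapT => ny.
  by apply: ne; exists e => //; exists y => x xy; apply: ny; exists x.
have [u0] : inhabited U by have [_ _ [y _]] := Ue; apply: inhabits y.
pose U0 := inhabits u0.
have Ua := base_has_amalgamation U Uh U0 Uc Ub.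
have Ounc := uncountable_set_nat.
have [C [Ctot [s0 Cs0] Cub]] := stage_chain Uh Uc U0 Ua Ounc Ue.
pose T := {s | C s}; pose t0 : T := exist _ s0 Cs0.
pose X := {o | exists t : T, range (place (sval t)) o}.
have vI : injective (sval : X -> set nat).
  by move=> x y; apply: eq_sig_hprop => *; apply: Prop_irrelevance.
pose i (t : T) (x : U) : X := exist _ (place (sval t) x)
  (ex_intro _ t (ex_intro2 _ _ x I erefl)).
have tot (s t : T) : stage_le (sval s) (sval t) \/ stage_le (sval t) (sval s).
  by apply: Ctot; apply: svalP.
have iI t : injective (i t) by move=> x y /(congr1 sval) /= /place_inj.
have cov x : exists t y, i t y = x.
  by have [t [y _ e]] := svalP x; exists t, y; apply: vI.
have [|F [R ie]] := colimit_structure U i (inhabits t0) iI cov.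
  move=> s t; have [[k [ke kp _]]|[k [ke kp _]]] := tot s t.
    by exists t, k, id; split=> // [|x]; [apply: embedding_id|apply: vI; apply: kp].
  by exists s, id, k; split=> // [|x]; [apply: embedding_id|apply: vI; apply: kp].
pose M : structure L := Structure F R; exists M.
have ri (s t : T) : stage_le (sval s) (sval t) -> range (i s) `<=` range (i t).
  by move=> [k [_ kp _]] _ [x _ <-]; exists (k x) => //; apply: vI; rewrite /= kp.
have fin (G : set M) : finite_set G -> exists s, G `<=` range (i s).
  apply: finite_cover; first exact: inhabits t0.
    move=> s t; have [/ri st|/ri ts] := tot s t.
      by exists t; split=> //; apply: st.
    by exists s; split=> //; apply: ts.
  by move=> x; have [t [y <-]] := cov x; exists t, y.
split.
- exact: (stages_homogeneous U M (fun t : T => sval t) i sval).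
- split.
    (* If [e] enumerated [M], some [t] in the chain would lie above copies containing all the [e n],
       and no [t'] strictly above [t] could have a new point. *)
    move=> /(countable_surj (i t0 u0))[e eP].
    have /choice[s sP] : forall n, exists t : T, range (place (sval t)) (sval (e n)).
      by move=> n; apply: svalP (e n).
    have [t Ct st] := Cub _ (fun n => svalP (s n)).
    have [t' Ct' /(_ 0)[tt' nt't]] := Cub (fun=> t) (fun=> Ct).
    apply: nt't; apply: stage_le_antisym tt' _ => _ [x _ <-].
    have [n en] := eP (i (exist _ t' Ct') x).
    have [/stage_le_range snt _] := st n.
    by apply: snt; have := sP n; rewrite en.
  move=> Y Yunc.
  have [s t Cs Ct|s Cs|j jI] := bigcup_chain_card_le C (fun s => range (place s)) _ _ Yunc.
  + by have [/stage_le_range|/stage_le_range] := Ctot s t Cs Ct; [left|right].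
  + exact: sub_countable (card_image_le _ _) Uc.
  have vC (x : X) : (\bigcup_(s in C) range (place s)) (sval x).
    by have [t tx] := svalP x; exists (sval t) => //; apply: svalP.
  have jvI : {in [set: X] &, injective (j \o sval)}.
    by move=> x y _ _ /= /jI/vI; apply.
  rewrite -(card_le_eql (inj_card_eq jvI)); exact: subset_card_le.
- move=> A; split=> -[Afg [h he]]; split=> //; last first.
    by exists (i t0 \o h); apply: embedding_comp.
  (* The images of finitely many generators lie in one copy of [U], and with them the image of
     [A]. *)
  have [Z [Zf gZ]] := Afg.
  have [|s sP] := fin (h @` Z); first exact: finite_image.
  have [|f fe _] := lift_embedding A U M h (i s) he (ie s); last by exists f.
  by apply: generated_range gZ he (ie s) _ => z Zz; apply: sP; exists z.
Qed.
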